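(* Let $R=(r_1,r_2,\ldots,r_n)$ be a vector of nonnegative integers with $r_1\le r_2\le\cdots\le r_n$. Then there exists a loopy tournament with score vector $R$ if and only if there is an integer $t$ with $0\le t\le n$ such that $$\sum_{i=1}^k r_i\ge \binom{k}{2}+(k-t)^+\quad (k=1,2,\ldots,n),\ \mbox{ with equality when } k=n.$$ When these conditions are satisfied, the number of $1$s on the main diagonal of the loopy tournament is $n-t$, and these can be taken to be in the last $n-t$ positions on the main diagonal (that is, there is a loopy tournament with score vector $R$ whose $1$s on the main diagonal are exactly in the last $n-t$ positions).
   Context: A loopy tournament of order $n$ is an $n\times n$ $(0,1)$-matrix $T=[t_{ij}]$ with $t_{ij}=1-t_{ji}$ for $i\ne j$, where each diagonal entry $t_{ii}$ may be $0$ or $1$. Its score vector is the vector of row sums of $T$ (diagonal entries included). For an integer $a$, $a^+=\max\{0,a\}$. *)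

(* Defs.v *)
From mathcomp Require Import all_boot all_algebra.
Set Implicit Arguments.
Unset Strict Implicit.
Unset Printing Implicit Defensive.

(* Positions 1, ..., n are the ordinals 0, ..., n - 1 of 'I_n. *)

(* The subtraction on nat does not truncate here, since entries are 0 or 1. *)
Definition loopy_tournament (n : nat) (T : 'M[nat]_n) : Prop :=
  (forall i j : 'I_n, T i j = 0 \/ T i j = 1) /\
  (forall i j : 'I_n, i != j -> T i j = 1 - T j i).

Definition score_vector (n : nat) (T : 'M[nat]_n) : {ffun 'I_n -> nat} :=
  [ffun i => \sum_(j < n) T i j].

Definition diag_ones (n : nat) (T : 'M[nat]_n) : {set 'I_n} :=
  [set i | T i i == 1].

(* Truncated subtraction on nat: k - t is the positive part (k - t)^+. *)
Definition loopy_score_condition (n : nat) (R : {ffun 'I_n -> nat}) (t : nat)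
    : Prop :=
  (forall k : nat, 1 <= k <= n ->
     \sum_(i < n | i < k) R i >= 'C(k, 2) + (k - t)) /\
  \sum_(i < n) R i = 'C(n, 2) + (n - t).

(* Main.v *)
Require Import Defs.
From mathcomp Require Import all_boot all_algebra.
From mathcomp Require Import zify.

(** Necessity is double counting: inside a set S of positions, each of the
    'C(#|S|, 2) pairs contributes one 1, and the loops in S contribute the
    rest ([score_sum_block]).  For S = setT this is the equality at k = n, and
    it shows that the score vector alone fixes the number of loops.  For a
    prefix of length k, at most t of its positions have no loop, which gives
    the inequality.

    Sufficiency has two stages.  The first forgets where the loops are.  Start
    from the transitive tournament with n - t loops and move one unit of score
    at a time from a position with too large a score to one with too small a
    score.  A unit goes from x to y either by reversing an arc that x wins, or
    by handing the loop of x to a loopless y; chaining such steps along a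
    simple path moves a unit between its ends ([connect_transfer]).  If no
    deficient position can be reached from an excessive x, the set S of
    positions reachable from x is closed.  Then S wins no arc leaving it, and
    it contains either no loop at all or every loopless position, so its total
    score is at most 'C(#|S|, 2) + (#|S| - t) ([closed_score_sum]).  This
    total exceeds the sum of R over S, which contradicts the hypothesis,
    since for a nondecreasing R the prefix of length #|S| has the least sum
    ([prefix_sum_le]).  Allowing loops to move is what makes the hypothesis on
    prefixes enough here: with loops kept fixed, R minus the loops need not
    be nondecreasing.

    The second stage moves the loops to the end without changing any score.
    If i has a loop, j has none and the score of i is at most that of j, then
    j wins strictly more arcs than i, so j beats i directly or through some k.
    Handing the loop of i to j moves one unit from i to j, and reversing those
    arcs brings it back ([exchange_loops]). *)

(** * Counting positions and scores *)

Section Loopy.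
Variable n : nat.
Implicit Types (t : nat) (T : 'M[nat]_n) (R : {ffun 'I_n -> nat}) (S : {set 'I_n}).

Lemma card_le_order S : #|S| <= n.
Proof. by have := max_card S; rewrite card_ord. Qed.

Lemma card_first k : k <= n -> #|[set i : 'I_n | i < k]| = k.
Proof.
move=> le_kn; rewrite -sum1_card (eq_bigl (fun i : 'I_n => i < k)).
  by rewrite -(big_ord_widen n (fun=> 1) le_kn) sum1_card card_ord.
by move=> i; rewrite inE.
Qed.

Lemma card_last k : k <= n -> #|[set i : 'I_n | k <= i]| = n - k.
Proof.
move=> le_kn; have := cardsC [set i : 'I_n | i < k].
rewrite card_first // card_ord => cardE.
have -> : n - k = #|~: [set i : 'I_n | i < k]| by lia.
by apply: eq_card => i; rewrite !inE -leqNgt.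
Qed.

Lemma entry_le1 T i j : loopy_tournament T -> T i j <= 1.
Proof. by case=> T01 _; case: (T01 i j) => ->. Qed.

(** Adding the block to its transpose turns every off-diagonal entry into 1
    and doubles the diagonal. *)
Lemma score_sum_block T S : loopy_tournament T ->
  \sum_(i in S) \sum_(j in S) T i j = 'C(#|S|, 2) + #|S :&: diag_ones T|.
Proof.
move=> lT; set L := (LHS).
have diagE : #|S :&: diag_ones T| = \sum_(i in S) T i i.
  rewrite -sum1_card big_mkcond [RHS]big_mkcond.
  apply: eq_bigr => i _; rewrite !inE; case: (i \in S) => //=.
  by case: lT => T01 _; case: (T01 i i) => ->.
have twice : L + L = #|S| * #|S|.-1 + 2 * #|S :&: diag_ones T|.
  rewrite {2}/L exchange_big -big_split diagE big_distrr /=.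
  rewrite -sum_nat_const -big_split; apply: eq_bigr => i Si /=.
  rewrite -big_split (bigD1 i) //= addnC.
  congr (_ + _); last by rewrite mul2n addnn.
  rewrite [LHS](eq_bigr (fun=> 1)) => [|j /andP[_ neq_ji]].
    rewrite sum1_card [#|S|](cardD1 i) Si /=.
    by apply: eq_card => j; rewrite !inE andbC.
  by case: (lT) => _ Tanti; rewrite (Tanti i j) 1?eq_sym // subnK // entry_le1.
have := bin2 #|S|; have := odd_double_half (#|S| * #|S|.-1).
have -> : odd (#|S| * #|S|.-1) = false by case: #|S| => //= k; rewrite oddM /= andNb.
rewrite -mul2n; lia.
Qed.

Lemma score_sum_total T : loopy_tournament T ->
  \sum_i score_vector T i = 'C(n, 2) + #|diag_ones T|.
Proof.
move=> lT; have := score_sum_block _ [set: 'I_n] lT.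
rewrite setTI cardsT card_ord => <-.
rewrite [RHS](eq_bigl xpredT); last by move=> i; rewrite inE.
apply: eq_bigr => i _; rewrite ffunE.
by apply: eq_bigl => j; rewrite inE.
Qed.

Lemma score_sum_ge T S : loopy_tournament T ->
  'C(#|S|, 2) + #|S :&: diag_ones T| <= \sum_(i in S) score_vector T i.
Proof.
move=> lT; rewrite -score_sum_block //; apply: leq_sum => i _.
rewrite ffunE [X in X <= _]big_mkcond; apply: leq_sum => j _.
by case: ifP.
Qed.

Lemma loopy_score_necessary T : loopy_tournament T ->
  loopy_score_condition (score_vector T) (n - #|diag_ones T|).
Proof.
move=> lT; have leD := card_le_order (diag_ones T).
split; last by rewrite score_sum_total // subKn.
move=> k /andP[_ le_kn]; set S := [set i : 'I_n | i < k].
rewrite (eq_bigl (mem S)); last by move=> i; rewrite !inE.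
apply: leq_trans (score_sum_ge _ S lT); rewrite card_first // leq_add2l.
have := cardsID (diag_ones T) S; rewrite card_first // => cardS.
have : #|S :\: diag_ones T| <= #|~: diag_ones T| by rewrite subset_leq_card // setDE subsetIr.
have := cardsC (diag_ones T); rewrite card_ord => cardD le_diff.
by rewrite -[X in X - #|_|]cardD addKn leq_subLR -cardS addnC leq_add2r.
Qed.

(** S and the prefix P of the same size differ by sets P :\: S and S :\: P of
    equal size, and the largest value of R on the first is at most every value
    on the second. *)
Lemma prefix_sum_le R S : (forall i j : 'I_n, i <= j -> R i <= R j) ->
  \sum_(i < n | i < #|S|) R i <= \sum_(i in S) R i.
Proof.
move=> Rmono; set P := [set i : 'I_n | i < #|S|].
have le_Sn := card_le_order S.
rewrite (eq_bigl (mem P)); last by move=> i; rewrite !inE.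
rewrite (big_setID S) [X in _ <= X](big_setID P) /= setIC leq_add2l.
have cardDD : #|P :\: S| = #|S :\: P|.
  by apply/eqP; rewrite -(eqn_add2l #|S :&: P|) {1}setIC !cardsID card_first.
pose r := \max_(i in P :\: S) R i.
apply: (@leq_trans (#|S :\: P| * r)).
  rewrite -cardDD -sum_nat_const; apply: leq_sum => i iP.
  exact: leq_bigmax_cond.
rewrite -sum_nat_const; apply: leq_sum => i; rewrite !inE -leqNgt => /andP[Pi _].
apply/bigmax_leqP => j; rewrite !inE => /andP[_ jP].
by apply: Rmono; lia.
Qed.

(** * Moving units of score *)

(** The unit is added on both sides to avoid a subtraction, so the relation is
    meaningful for x = y, where it says that the scores agree. *)
Definition transfers (x y : 'I_n) T T' : Prop :=
  forall v, score_vector T' v + (v == x) = score_vector T v + (v == y).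

Lemma transfers_trans {x z} y {T T1 T2} :
  transfers x y T T1 -> transfers y z T1 T2 -> transfers x z T T2.
Proof. by move=> t1 t2 v; move: (t1 v) (t2 v); lia. Qed.

Lemma transfers_id x T T' : transfers x x T T' -> score_vector T' = score_vector T.
Proof. by move=> tr; apply/ffunP => v; apply: addIn (tr v). Qed.

Lemma transfers_sum x y T T' : transfers x y T T' ->
  \sum_i score_vector T' i = \sum_i score_vector T i.
Proof.
move=> tr; apply/eqP; rewrite -(eqn_add2r 1); apply/eqP.
have one (z : 'I_n) : \sum_i (i == z : nat) = 1.
  by rewrite (bigD1 z) //= eqxx big1 // => i /negPf->.
rewrite -[in LHS](one x) -[in RHS](one y) -!big_split.
by apply: eq_bigr => i _; apply: tr.
Qed.

(** The common shape of the two elementary moves: the 1 at (x, u) is removed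
    and a 1 is placed at (y, v).  The result is a loopy tournament only for the
    choices of u and v made in [flip_arc] and [move_loop]. *)
Definition move_one T (x u y v : 'I_n) : 'M[nat]_n :=
  \matrix_(i, j) (if (i == x) && (j == u) then 0
                  else if (i == y) && (j == v) then 1 else T i j).

Lemma move_one_transfers T x u y v : T x u = 1 -> T y v = 0 ->
  transfers x y T (move_one T x u y v).
Proof.
move=> Txu Tyv w; rewrite !ffunE.
have one (b : bool) (z : 'I_n) : nat_of_bool b = \sum_j (b && (j == z) : nat).
  case: b; last by rewrite big1.
  by rewrite (bigD1 z) //= eqxx big1 // => i /negPf->.
rewrite (one (w == x) u) (one (w == y) v) -!big_split /=.
apply: eq_bigr => j _; rewrite mxE.
have [/andP[/eqP-> /eqP->]|_] := boolP ((w == x) && (j == u)).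
  have [/andP[/eqP xy /eqP uv]|_] := boolP (_ && _); last by rewrite Txu.
  by rewrite xy uv Tyv in Txu.
by have [/andP[/eqP-> /eqP->]|_] := boolP (_ && _); rewrite ?Tyv.
Qed.

Definition flip_arc T x y := move_one T x y y x.
Definition move_loop T x y := move_one T x x y y.

Lemma flip_arc_loopy T x y : loopy_tournament T -> x != y ->
  loopy_tournament (flip_arc T x y).
Proof.
case=> T01 Tanti neq_xy; split=> i j.
  by rewrite mxE; do 2?case: ifP => _; auto.
move=> neq_ij; rewrite !mxE [(j == x) && _]andbC [(j == y) && _]andbC.
have [/andP[/eqP-> /eqP->]|_] := boolP ((i == x) && (j == y)).
  by rewrite (negPf neq_xy).
by case: ifP => // _; apply: Tanti.
Qed.

Lemma move_loop_loopy T x y : loopy_tournament T -> loopy_tournament (move_loop T x y).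
Proof.
case=> T01 Tanti; split=> i j.
  by rewrite mxE; do 2?case: ifP => _; auto.
have off a b c : a != b -> (a == c) && (b == c) = false :> bool.
  by move=> ne; apply/negP => /andP[/eqP ac /eqP bc]; rewrite ac bc eqxx in ne.
move=> neq_ij; rewrite !mxE !off //; first exact: Tanti.
all: by rewrite eq_sym.
Qed.

(** The pairs joined by a single elementary move: x beats y, or x has a loop
    that y can take over. *)
Definition step T : rel 'I_n := fun x y =>
  (x != y) && ((T x y == 1) || (T x x == 1) && (T y y == 0)).

(** The last clause lets the rest of a simple path through x and y survive
    the move.  After x -> y the path may only leave y, never enter it: when y
    has just received a loop, the steps that would hand it another loop are
    lost, whereas the steps out of y only gain. *)
Lemma step_transfer T x y : loopy_tournament T -> step T x y ->
  exists T', [/\ loopy_tournament T', transfers x y T T' &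
    forall a b, a != x -> b != x -> b != y -> step T a b -> step T' a b].
Proof.
move=> lT /andP[neq_xy /orP[/eqP Txy|/andP[/eqP Txx /eqP Tyy]]].
  have Tyx : T y x = 0 by case: lT => _ ->; rewrite ?Txy // eq_sym.
  exists (flip_arc T x y); split; first exact: flip_arc_loopy.
    exact: move_one_transfers.
  move=> a b ax bx bY; rewrite /step !mxE (negPf ax) (negPf bx) (negPf bY) /=.
  by rewrite !andbF.
exists (move_loop T x y); split; first exact: move_loop_loopy.
  exact: move_one_transfers.
move=> a b ax bx bY; rewrite /step !mxE (negPf ax) (negPf bx) (negPf bY) /=.
by rewrite !andbF; case: (a == y) => //= /andP[-> /orP[->|/andP[_ ->]]] //; rewrite orbT.
Qed.

Lemma path_transfer T x p : loopy_tournament T ->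
  path (step T) x p -> uniq (x :: p) ->
  exists2 T', loopy_tournament T' & transfers x (last x p) T T'.
Proof.
elim: p x T => [|y p IHp] x T lT; first by exists T.
move=> /= /andP[Txy pth] /and3P[]; rewrite inE negb_or => /andP[neq_xy xp] yp up.
have [T1 [lT1 tr1 keep]] := step_transfer _ _ _ lT Txy.
have keep_path a q : a != x -> x \notin q -> y \notin q ->
    path (step T) a q -> path (step T1) a q.
  elim: q a => //= b q IHq a ax.
  rewrite !inE !negb_or => /andP[xb xq] /andP[yb yq] /andP[Tab pth_q].
  by rewrite keep // 1?eq_sym //= IHq // eq_sym.
have pth1 : path (step T1) y p by apply: keep_path => //; rewrite eq_sym.
have [|T2 lT2 tr2] := IHp y T1 lT1 pth1; first by rewrite /= yp.
by exists T2 => //; apply: transfers_trans tr1 tr2.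
Qed.

Lemma connect_transfer T x y : loopy_tournament T -> connect (step T) x y ->
  exists2 T', loopy_tournament T' & transfers x y T T'.
Proof.
move=> lT /connectP[p pth ->]; case/shortenP: pth => q pth uq _.
exact: path_transfer.
Qed.

(** Closure under arcs means that S wins nothing outside itself, so its score
    is that of its own block.  Closure under loop moves means that as soon as
    S holds one loop it contains every loopless position. *)
Lemma closed_score_sum T S : loopy_tournament T ->
  (forall i j, i \in S -> step T i j -> j \in S) ->
  \sum_(i in S) score_vector T i <= 'C(#|S|, 2) + (#|S| - #|~: diag_ones T|).
Proof.
move=> lT clS.
have -> : \sum_(i in S) score_vector T i = 'C(#|S|, 2) + #|S :&: diag_ones T|.
  rewrite -score_sum_block //; apply: eq_bigr => i Si; rewrite ffunE.
  rewrite [RHS]big_mkcond; apply: eq_bigr => j _; case: ifP => // nSj.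
  case: (lT) => T01 _; case: (T01 i j) => // Tij.
  have neq_ij : i != j by apply: contraFneq nSj => <-.
  by have := clS i j Si; rewrite nSj /step neq_ij Tij => /(_ isT).
rewrite leq_add2l; have [->|[i]] := set_0Vmem (S :&: diag_ones T).
  by rewrite cards0.
rewrite !inE => /andP[Si /eqP Tii].
have sub : ~: diag_ones T \subset S.
  apply/subsetP => j; rewrite !inE => Tjj.
  apply: (clS i) => //; rewrite /step Tii /=.
  have Tj0 : T j j = 0 by case: (lT) => T01 _; case: (T01 j j) Tjj => ->.
  by rewrite Tj0 orbT andbT; apply: contraNneq Tjj => <-; rewrite Tii.
have := cardsID (diag_ones T) S; rewrite setDE.
by rewrite (setIidPr sub); lia.
Qed.

(** * Realizing a score vector *)

Definition transitive_loopy t : 'M[nat]_n :=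
  \matrix_(i, j) ((j < i) || (i == j) && (t <= i) : nat).

Lemma transitive_loopyP t : loopy_tournament (transitive_loopy t).
Proof.
split=> i j; rewrite !mxE; first by case: (_ || _); [right|left].
by move=> ne; rewrite [j == i]eq_sym (negPf ne) !orbF; move: ne; rewrite -val_eqE /=; lia.
Qed.

Lemma diag_transitive_loopy t : diag_ones (transitive_loopy t) = [set i : 'I_n | t <= i].
Proof. by apply/setP => i; rewrite !inE mxE ltnn eqxx /=; case: (t <= i). Qed.

(** Descent on the total excess of the scores over R.  The total score is
    preserved by transfers, so no excess left means equality everywhere, and
    the number of loops stays equal to n - t throughout. *)
Lemma loopy_score_exists R t : (forall i j : 'I_n, i <= j -> R i <= R j) ->
  t <= n -> loopy_score_condition R t ->
  exists2 T, loopy_tournament T & score_vector T = R.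
Proof.
move=> Rmono le_tn [Rge Rtot].
pose excess T := \sum_i (score_vector T i - R i).
suff reduce m T : excess T < m -> loopy_tournament T ->
    \sum_i score_vector T i = \sum_i R i ->
    exists2 T', loopy_tournament T' & score_vector T' = R.
  apply: (reduce _ (transitive_loopy t) (leqnn _)); first exact: transitive_loopyP.
  rewrite score_sum_total; last exact: transitive_loopyP.
  by rewrite diag_transitive_loopy card_last.
elim: m T => // m IHm T exT lT sumT.
have [/forallP le_all|] := boolP [forall i, score_vector T i <= R i].
  exists T => //; apply/ffunP => i; apply/eqP.
  have [_] := leqif_sum (fun i (_ : true) => leqif_eq (le_all i)).
  by rewrite sumT eqxx => /esym/forallP/(_ i).
rewrite negb_forall => /existsP[x]; rewrite -ltnNge => gtx.
pose S := [set y | connect (step T) x y].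
have Sx : x \in S by rewrite inE connect0.
have [/existsP[y]|] := boolP [exists y, (y \in S) && (score_vector T y < R y)].
  rewrite inE => /andP[/(connect_transfer _ _ _ lT)[T1 lT1 tr] lty].
  apply: (IHm T1) => //; last by rewrite (transfers_sum _ _ _ _ tr).
  rewrite -ltnS; apply: leq_ltn_trans exT; rewrite /excess.
  rewrite (bigD1 x) // [X in _ <= X](bigD1 x) //= -addSn; apply: leq_add.
    by move: (tr x); rewrite eqxx; case: eqVneq => [xy|_]; subst; lia.
  by apply: leq_sum => i ix; move: (tr i); rewrite (negPf ix); case: eqVneq => [->|_]; lia.
rewrite negb_exists => /forallP noDef.
have card_loopless : #|~: diag_ones T| = t.
  have := cardsC (diag_ones T); have := score_sum_total _ lT.
  by rewrite sumT Rtot card_ord; lia.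
have clS i j : i \in S -> step T i j -> j \in S.
  by rewrite !inE => ci sij; apply: connect_trans ci (connect1 sij).
have := closed_score_sum _ _ lT clS; rewrite card_loopless.
have S0 : 1 <= #|S| <= n.
  by rewrite card_le_order andbT card_gt0; apply/set0Pn; exists x.
(* S has only scores at least those of R, and x gives a strict inequality. *)
move=> le1; have := leq_trans le1 (leq_trans (Rge _ S0) (prefix_sum_le _ _ Rmono)).
rewrite (bigD1 x) // [X in _ <= X](bigD1 x) //= leqNgt -addSn leq_add //.
apply: leq_sum => i /andP[Si _]; move: (noDef i); rewrite Si /=; lia.
Qed.

(** * Moving the loops to the end *)

Lemma diag_flip_arc T x y : x != y -> diag_ones (flip_arc T x y) = diag_ones T.
Proof.
move=> ne; apply/setP => i; rewrite !inE mxE.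
by case: (eqVneq i x) => [->|_] /=; rewrite ?(negPf ne) ?andbF.
Qed.

Lemma diag_move_loop T x y : x != y ->
  diag_ones (move_loop T x y) = y |: diag_ones T :\ x.
Proof.
move=> ne; apply/setP => i; rewrite !inE mxE !andbb.
case: (eqVneq i x) => [->|_]; first by rewrite (negPf ne).
by case: (i == y).
Qed.

(** Without loops, i has fewer wins than j, so j -> i is an arc or some k
    satisfies j -> k -> i; reversing these arcs repays the unit that the loop
    move took from i. *)
Lemma exchange_loops T i j : loopy_tournament T ->
  T i i = 1 -> T j j = 0 -> score_vector T i <= score_vector T j ->
  exists T', [/\ loopy_tournament T', score_vector T' = score_vector T &
    diag_ones T' = j |: diag_ones T :\ i].
Proof.
move=> lT Tii Tjj le_ij; have [T01 Tanti] := lT.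
have neq_ij : i != j by apply/eqP => E; rewrite -E Tii in Tjj.
have neq_ji : j != i by rewrite eq_sym.
pose T1 := move_loop T i j.
have lT1 : loopy_tournament T1 by exact: move_loop_loopy.
have tr1 : transfers i j T T1 by exact: move_one_transfers.
have D1 : diag_ones T1 = j |: diag_ones T :\ i by exact: diag_move_loop.
have T1off a b : a != b -> T1 a b = T a b.
  move=> ne; rewrite mxE; case: eqVneq => [ai|_] /=.
    by subst; rewrite eq_sym (negPf ne) (negPf neq_ij).
  by case: eqVneq => //= aj; subst; rewrite eq_sym (negPf ne).
(* The unit received by j goes back to i, first along an arc j -> i. *)
case: (T01 j i) => Tji; last first.
  exists (flip_arc T1 j i); split; first exact: flip_arc_loopy.
    apply: (@transfers_id i); apply: (transfers_trans j tr1).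
    by apply: move_one_transfers; rewrite T1off // Tanti // Tji.
  by rewrite diag_flip_arc.
have Tij : T i j = 1 by rewrite Tanti // Tji.
(* If row j were below row i everywhere, the strict inequality at column i
   would contradict the comparison of scores. *)
have [/existsP[k]|] := boolP [exists k, T i k < T j k]; last first.
  rewrite negb_exists => /forallP le_row.
  move: le_ij; rewrite !ffunE (bigD1 i) // [X in _ <= X](bigD1 i) //=.
  rewrite Tii Tji leqNgt ltnS leq_sum // => k _.
  by rewrite leqNgt; apply: le_row.
have [Tjk Tik] := (entry_le1 _ j k lT, entry_le1 _ i k lT) => lt_k.
have {Tjk} Tjk : T j k = 1 by lia.
have {lt_k} Tik : T i k = 0 by lia.
have neq_ik : i != k by apply/eqP => E; rewrite -E Tii in Tik.
have neq_jk : j != k by apply/eqP => E; rewrite -E Tjj in Tjk.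
have neq_kj : k != j by rewrite eq_sym.
have neq_ki : k != i by rewrite eq_sym.
have Tkj : T k j = 0 by rewrite Tanti // Tjk.
have Tki : T k i = 1 by rewrite Tanti // Tik.
pose T2 := flip_arc T1 j k.
have lT2 : loopy_tournament T2 by exact: flip_arc_loopy.
have tr2 : transfers j k T1 T2 by apply: move_one_transfers; rewrite T1off.
exists (flip_arc T2 k i); split; first exact: flip_arc_loopy.
  apply: (@transfers_id i); apply: (transfers_trans j tr1).
  apply: (transfers_trans k tr2); apply: move_one_transfers.
    by rewrite mxE (negPf neq_kj) eqxx (negPf neq_ij) /= T1off.
  by rewrite mxE (negPf neq_ij) (negPf neq_ik) /= T1off.
by rewrite !diag_flip_arc.
Qed.

(** Each exchange with i < t <= j removes one loop from the
    first t positions; such a j exists because the loops are n - t in number. *)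
Lemma loops_to_end t T : t <= n -> loopy_tournament T -> #|diag_ones T| = n - t ->
  (forall i j : 'I_n, i <= j -> score_vector T i <= score_vector T j) ->
  exists T', [/\ loopy_tournament T', score_vector T' = score_vector T &
    diag_ones T' = [set i : 'I_n | t <= i]].
Proof.
move=> le_tn; set L := [set i : 'I_n | t <= i].
have cardL : #|L| = n - t by exact: card_last.
have [m] := ubnP #|diag_ones T :\: L|.
elim: m T => // m IHm T le_m lT cardD mono.
have [/eqP|[i iDL]] := set_0Vmem (diag_ones T :\: L).
  rewrite setD_eq0 => sDL; exists T; split=> //; apply/eqP.
  by rewrite eqEcard sDL cardL cardD /=.
have [/eqP|[j jLD]] := set_0Vmem (L :\: diag_ones T).
  rewrite setD_eq0 => sLD.
  have eqLD : L = diag_ones T by apply/eqP; rewrite eqEcard sLD cardL cardD /=.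
  by move: iDL; rewrite -eqLD setDv inE.
move: (iDL) (jLD); rewrite !inE -ltnNge => /andP[lt_it /eqP Tii] /andP[nTjj le_tj].
have Tjj : T j j = 0 by case: (lT) => T01 _; case: (T01 j j) nTjj => ->.
have [|T1 [lT1 sT1 dT1]] := exchange_loops _ _ _ lT Tii Tjj.
  by apply: mono; lia.
have [||||T2 [lT2 sT2 dT2]] := IHm T1; rewrite ?sT1 //.
- have : diag_ones T1 :\: L \subset (diag_ones T :\: L) :\ i.
    rewrite dT1; apply/subsetP => k; rewrite !inE.
    by case: (eqVneq k j) => [->|_] /=; [rewrite le_tj | rewrite andbCA].
  move=> /subset_leq_card le1; apply: leq_ltn_trans le1 _.
  by move: le_m; rewrite (cardsD1 i) iDL.
- have := score_sum_total _ lT1; have := score_sum_total _ lT; rewrite sT1; lia.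
by exists T2; rewrite sT2.
Qed.

End Loopy.

Theorem theorem6 (n : nat) (R : {ffun 'I_n -> nat})
    (R_nondecr : forall i j : 'I_n, i <= j -> R i <= R j) :
  ((exists T : 'M[nat]_n, loopy_tournament T /\ score_vector T = R) <->
   (exists t : nat, t <= n /\ loopy_score_condition R t)) /\
  (forall t : nat, t <= n -> loopy_score_condition R t ->
     (forall T : 'M[nat]_n, loopy_tournament T -> score_vector T = R ->
        #|diag_ones T| = n - t) /\
     (exists T : 'M[nat]_n,
        [/\ loopy_tournament T, score_vector T = R
          & diag_ones T = [set i : 'I_n | t <= i]])).
Proof.
have loops_of_total t T : loopy_score_condition R t -> loopy_tournament T ->
    score_vector T = R -> #|diag_ones T| = n - t.
  by case=> _ Rtot lT sT; have := score_sum_total _ _ lT; rewrite sT Rtot; lia.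
split; first split.
- case=> T [lT <-]; exists (n - #|diag_ones T|); split; first exact: leq_subr.
  exact: loopy_score_necessary.
- case=> t [le_tn cond].
  by have [T] := loopy_score_exists _ _ _ R_nondecr le_tn cond; exists T.
move=> t le_tn cond; split; first by move=> T; apply: loops_of_total.
have [T lT sT] := loopy_score_exists _ _ _ R_nondecr le_tn cond.
rewrite -sT; apply: loops_to_end => //; first exact: loops_of_total.
by rewrite sT.
Qed.
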